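(* There exists a condensed finitely generated group $G$ that splits as a central extension of the form $$1\longrightarrow \mathbb{Z}_2\longrightarrow G\longrightarrow \mathbb{Z}^2\,\mathrm{wr}\,\mathbb{Z}\longrightarrow 1,$$ i.e. $G$ has a central subgroup isomorphic to $\mathbb{Z}_2=\mathbb{Z}/2\mathbb{Z}$ whose quotient is isomorphic to the restricted wreath product $\mathbb{Z}^2\,\mathrm{wr}\,\mathbb{Z}$.
   Context: The space of finitely generated marked groups. An $n$-generated marked group is a pair $(G,(a_1,\dots,a_n))$ where $G$ is a group generated by $a_1,\dots,a_n$; two such pairs $(G,(a_i))$, $(H,(b_i))$ are identified if $a_i\mapsto b_i$ extends to an isomorphism $G\to H$. Let $\mathcal G_n$ be the set of all $n$-generated marked groups. With $F_n$ free on $x_1,\dots,x_n$, the map sending $(G,(a_i))$ to the kernel of the epimorphism $F_n\to G$, $x_i\mapsto a_i$, is a bijection from $\mathcal G_n$ to the set of normal subgroups of $F_n$; the latter has the subspace topology from $2^{F_n}$ (product topology), and $\mathcal G_n$ has the pulled-back topology. The map $(G,(a_1,\dots,a_n))\mapsto(G,(a_1,\dots,a_n,1))$ is a continuous embedding $\mathcal G_n\to\mathcal G_{n+1}$, and $\mathcal G=\bigcup_n\mathcal G_n$ with the topological union topology ($U$ is open iff $U\cap\mathcal G_n$ is open in $\mathcal G_n$ for all $n$). For a finitely generated group $G$, its isomorphism class is $[G]=\{(H,B)\in\mathcal G\mid H\cong G\}$. A finitely generated group $G$ is condensed if $[G]$ (with the subspace topology from $\mathcal G$) has no isolated points. *)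

(* Defs.v *)
From HB Require Import structures.
From mathcomp Require Import all_boot all_order all_algebra.
From mathcomp Require Import finmap.
From mathcomp Require Import boolp classical_sets functions topology.

Set Implicit Arguments.
Unset Strict Implicit.
Unset Printing Implicit Defensive.

Local Open Scope classical_set_scope.
Local Open Scope quotient_scope.
Local Open Scope group_scope.

(* A letter [(x, false)] stands for the generator x, [(x, true)] for its
   inverse; the elements of the free group are the reduced words. *)
Section FreeGroup.
Variable X : choiceType.

Local Notation letter := (X * bool)%type.

Definition letter_inv (l : letter) : letter := (l.1, ~~ l.2).

Definition reduced (w : seq letter) : bool :=
  sorted (fun l m => m != letter_inv l) w.

Definition cons_red (l : letter) (w : seq letter) : seq letter :=
  if w is m :: w' then if m == letter_inv l then w' else l :: w else [:: l].

Definition cat_red (u v : seq letter) : seq letter := foldr cons_red v u.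

Lemma letter_invK : involutive letter_inv.
Proof. by case=> x b; rewrite /letter_inv /= negbK. Qed.

Lemma letter_invC (l m : letter) : (m == letter_inv l) = (l == letter_inv m).
Proof. by apply/eqP/eqP => ->; rewrite letter_invK. Qed.

Lemma reduced_tail l w : reduced (l :: w) -> reduced w.
Proof. exact: path_sorted. Qed.

Lemma cons_red_id l w : reduced (l :: w) -> cons_red l w = l :: w.
Proof. by case: w => //= m w /andP[/negPf ->]. Qed.

Lemma cons_red_reduced l w : reduced w -> reduced (cons_red l w).
Proof.
case: w => //= m w rw; case: ifPn => [_|nm]; first exact: reduced_tail rw.
by rewrite /reduced /= nm.
Qed.

Lemma cons_redK l w :
  reduced w -> cons_red l (cons_red (letter_inv l) w) = w.
Proof.
case: w => [|m w] rw; first by rewrite /= eqxx.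
rewrite {2}/cons_red letter_invK; case: eqP => [eml|_]; last by rewrite /= eqxx.
by rewrite -eml; apply: cons_red_id.
Qed.

Lemma cat_red_reduced u v : reduced v -> reduced (cat_red u v).
Proof. by move=> rv; elim: u => //= l u; apply: cons_red_reduced. Qed.

Lemma cat_red_nil u : reduced u -> cat_red u [::] = u.
Proof.
elim: u => //= l u IHu ru; rewrite IHu; first exact: cons_red_id.
exact: reduced_tail ru.
Qed.

Lemma cat_red_cons l u x : reduced x ->
  cat_red (cons_red l u) x = cons_red l (cat_red u x).
Proof.
case: u => //= m u rx; case: eqP => //= ->.
by rewrite cons_redK// cat_red_reduced.
Qed.

Lemma cat_redA u v x : reduced x ->
  cat_red u (cat_red v x) = cat_red (cat_red u v) x.
Proof. by move=> rx; elim: u => //= l u ->; rewrite cat_red_cons. Qed.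

Definition word_inv (w : seq letter) : seq letter := rev (map letter_inv w).

Lemma word_inv_reduced w : reduced w -> reduced (word_inv w).
Proof.
rewrite /reduced /word_inv rev_sorted sorted_map; apply: sub_sorted => l m /=.
by rewrite letter_invK eq_sym.
Qed.

Lemma cat_redVK w x : reduced x -> cat_red (word_inv w) (cat_red w x) = x.
Proof.
move=> rx; elim: w => //= l w IHw.
rewrite /word_inv /= rev_cons /cat_red foldr_rcons.
have := @cons_redK (letter_inv l) _ (cat_red_reduced w rx).
by rewrite letter_invK => ->.
Qed.

Lemma cat_redKV w x : reduced x -> cat_red w (cat_red (word_inv w) x) = x.
Proof.
elim: w x => //= l w IHw x rx.
rewrite /word_inv /= rev_cons {2}/cat_red foldr_rcons.
by rewrite IHw ?cons_red_reduced// cons_redK.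
Qed.

Definition free_group := {w : seq letter | reduced w}.

HB.instance Definition _ := Choice.on free_group.

Definition free_one : free_group := Sub [::] isT.
Definition free_mul (u v : free_group) : free_group :=
  Sub (cat_red (val u) (val v)) (cat_red_reduced _ (valP v)).
Definition free_inv (u : free_group) : free_group :=
  Sub (word_inv (val u)) (word_inv_reduced (valP u)).

Fact free_mulA : associative free_mul.
Proof. by move=> u v w; apply/val_inj; apply: cat_redA (valP w). Qed.
Fact free_mul1 : left_id free_one free_mul.
Proof. by move=> u; apply/val_inj. Qed.
Fact free_mulr1 : right_id free_one free_mul.
Proof. by move=> u; apply/val_inj; apply: cat_red_nil (valP u). Qed.
Fact free_mulV : left_inverse free_one free_inv free_mul.
Proof.
move=> u; apply/val_inj; rewrite /= -{2}(cat_red_nil (valP u)).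
exact: cat_redVK.
Qed.
Fact free_mulrV : right_inverse free_one free_inv free_mul.
Proof.
move=> u; apply/val_inj; rewrite /=.
by rewrite -(cat_red_nil (word_inv_reduced (valP u))) cat_redKV.
Qed.

HB.instance Definition _ := isGroup.Build free_group
  free_mulA free_mul1 free_mulr1 free_mulV free_mulrV.

Definition free_gen (x : X) : free_group := Sub [:: (x, false)] isT.

Section Eval.
Variables (G : groupType) (a : X -> G).

Definition eval_letter (l : letter) : G := if l.2 then (a l.1)^-1 else a l.1.

Definition free_eval (w : free_group) : G :=
  \prod_(l <- val w) eval_letter l.

Lemma eval_letterV l : eval_letter (letter_inv l) = (eval_letter l)^-1.
Proof. by case: l => x [] //=; rewrite /eval_letter /= invgK. Qed.

Lemma free_eval_gen x : free_eval (free_gen x) = a x.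
Proof. by rewrite /free_eval big_seq1. Qed.

Fact free_evalM : {morph free_eval : u v / u * v}.
Proof.
case=> u ru [v rv]; rewrite /free_eval /=; elim: u {ru} => [|l u IHu] /=.
  by rewrite big_nil mul1g.
rewrite big_cons -mulgA -IHu; case: (cat_red u v) => [|m w] /=.
  by rewrite big_seq1 big_nil mulg1.
case: eqP => [->|_]; last by rewrite big_cons.
by rewrite big_cons eval_letterV mulgA mulgV mul1g.
Qed.

HB.instance Definition _ :=
  isUMagmaMorphism.Build free_group G free_eval (big_nil _ _ _ _, free_evalM).

End Eval.

Lemma free_eval_id (w : free_group) : free_eval free_gen w = w.
Proof.
apply/val_inj; case: w => w rw; rewrite /free_eval /=.
elim: w rw => [|l w IHw] rw; first by rewrite big_nil.
rewrite big_cons /= IHw ?(reduced_tail rw)// -[RHS](cons_red_id rw).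
by case: l {rw} => x [].
Qed.

End FreeGroup.

Lemma morph1 (G H : groupType) (f : {multiplicative G -> H}) : f 1 = 1.
Proof. by apply: (mulgI (f 1)); rewrite -gmulfM !mulg1. Qed.

Lemma morphV (G H : groupType) (f : {multiplicative G -> H}) x :
  f x^-1 = (f x)^-1.
Proof. by apply: (mulgI (f x)); rewrite -gmulfM !mulgV morph1. Qed.

Lemma morph_free_eval (X : choiceType) (G H : groupType)
    (f : {multiplicative G -> H}) (a : X -> G) (w : free_group X) :
  f (free_eval a w) = free_eval (f \o a) w.
Proof.
rewrite /free_eval (big_morph f (@gmulfM _ _ f) (morph1 f)).
by apply: eq_bigr => -[x []] _; rewrite /eval_letter /= ?morphV.
Qed.

Definition generates (I : Type) (G : groupType) (a : I -> G) : Prop :=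
  forall H : {pred G}, group_closed H -> (forall i, a i \in H) ->
  forall x, x \in H.

Definition finitely_generated (G : groupType) : Prop :=
  exists (n : nat) (a : 'I_n -> G), generates a.

Definition isomorphic (G H : groupType) : Prop :=
  exists f : {multiplicative G -> H}, bijective f.

Lemma generatesP (X : choiceType) (G : groupType) (a : X -> G) :
  generates a <-> forall x, exists w, free_eval a w = x.
Proof.
split=> [gen x|surj H [H1 HF] aH x].
  pose H : {pred G} := [pred y | `[< exists w, free_eval a w = y >]].
  suff /asboolP : x \in H by [].
  apply: gen => [|i]; last by apply/asboolP; exists (free_gen i); rewrite free_eval_gen.
  split; first by apply/asboolP; exists 1; rewrite gmulf1.
  move=> _ _ /asboolP[u <-] /asboolP[v <-]; apply/asboolP; exists (u / v).
  by rewrite gmulfF.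
have [w <-] := surj x.
have HC : group_closed H by split.
rewrite /free_eval; elim/big_ind: _ => // [|[i []] _]; last 2 first.
- exact: group_closedV HC _ (aH i).
- exact: aH.
exact: group_closedM HC.
Qed.

(* [iso_mapping a b]: the assignment a_i |-> b_i extends to an isomorphism. *)
Definition iso_mapping (I : Type) (G H : groupType) (a : I -> G) (b : I -> H) :
    Prop :=
  exists2 f : {multiplicative G -> H}, bijective f & forall i, f (a i) = b i.

Section IsoMapping.
Variable I : Type.

Lemma iso_mapping_refl (G : groupType) (a : I -> G) : iso_mapping a a.
Proof. by exists idfun => //; exists idfun. Qed.

Lemma iso_mapping_sym (G H : groupType) (a : I -> G) (b : I -> H) :
  iso_mapping a b -> iso_mapping b a.
Proof.
move=> [f [g fK gK] fab].
pose gM := isMultiplicative.Build H G g (can2_gmulfM fK gK).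
pose g' : {multiplicative H -> G} := HB.pack g gM.
by exists g' => [|i]; [exists f|rewrite /= -fab fK].
Qed.

Lemma iso_mapping_trans (G H K : groupType)
    (a : I -> G) (b : I -> H) (c : I -> K) :
  iso_mapping a b -> iso_mapping b c -> iso_mapping a c.
Proof.
move=> [f fbij fab] [g gbij gbc]; exists (g \o f : {multiplicative G -> K}).
  exact: bij_comp.
by move=> i /=; rewrite fab gbc.
Qed.

End IsoMapping.

Record marked_group (n : nat) := MarkedGroup {
  mg_group :> groupType;
  mg_gen : 'I_n -> mg_group;
  mg_genP : generates mg_gen
}.

Definition marked_iso n (M N : marked_group n) : Prop :=
  iso_mapping (@mg_gen n M) (@mg_gen n N).

Definition normal_closed (F : groupType) (N : {pred F}) : Prop :=
  group_closed N /\ {in N, forall x y, x ^ y \in N}.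

Record normal_subgroup (F : groupType) := NormalSubgroup {
  ns_set : F -> bool;
  ns_normal : normal_closed ns_set
}.

HB.instance Definition _ (F : groupType) := gen_eqMixin (normal_subgroup F).
HB.instance Definition _ (F : groupType) := gen_choiceMixin (normal_subgroup F).

Lemma ns_set_inj (F : groupType) : injective (@ns_set F).
Proof.
by move=> [N nN] [K nK] /= NK; case: _ / NK in nK *; rewrite (Prop_irrelevance nN nK).
Qed.

Section Preimage.
Variables (F K : groupType) (f : {multiplicative F -> K}).

Fact preim_normal (N : normal_subgroup K) :
  normal_closed (fun x => ns_set N (f x)).
Proof.
case: N => N [[N1 NF] NJ]; rewrite /= in N1 NF NJ *; split; first split.
- by rewrite unfold_in morph1; apply: N1.
- by move=> x y xN yN; rewrite unfold_in gmulfM morphV; apply: NF.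
- by move=> x xN y; rewrite unfold_in /conjg !gmulfM morphV; apply: NJ.
Qed.

Definition preim_ns (N : normal_subgroup K) : normal_subgroup F :=
  NormalSubgroup (preim_normal N).

End Preimage.

Fact trivial_normal (G : groupType) : normal_closed (pred1 (1 : G)).
Proof.
split; first (split=> [|x y]; rewrite !inE ?eqxx// => /eqP-> /eqP->).
  by rewrite divg1.
by move=> x; rewrite !inE => /eqP-> y; rewrite inE conj1g.
Qed.

(* The kernel of the epimorphism F_n -> G, x_i |-> a_i. *)
Definition mg_kernel n (M : marked_group n) : normal_subgroup (free_group 'I_n) :=
  preim_ns (free_eval (@mg_gen n M)) (NormalSubgroup (@trivial_normal M)).

Lemma mg_kernelE n (M : marked_group n) w :
  ns_set (mg_kernel M) w = (free_eval (@mg_gen n M) w == 1).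
Proof. by []. Qed.

Lemma mg_kernel_eq n (M : marked_group n) u v :
  ns_set (mg_kernel M) (u / v) =
    (free_eval (@mg_gen n M) u == free_eval (@mg_gen n M) v).
Proof. by rewrite mg_kernelE gmulfF divg_eq1. Qed.

Lemma mg_kernelP n (M N : marked_group n) :
  mg_kernel M = mg_kernel N <-> marked_iso M N.
Proof.
split=> [MN|[f fbij fMN]]; last first.
  apply/ns_set_inj/funext => w.
  rewrite !mg_kernelE -(inj_eq (bij_inj fbij)) morph1 morph_free_eval.
  by have -> : f \o @mg_gen n M = @mg_gen n N by apply/funext => i; apply: fMN.
have MNE u v : free_eval (@mg_gen n M) u = free_eval (@mg_gen n M) v <->
    free_eval (@mg_gen n N) u = free_eval (@mg_gen n N) v.
  by have := mg_kernel_eq M u v; rewrite MN mg_kernel_eq => E;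
    split=> /eqP; [rewrite -E|rewrite E] => /eqP.
have /choice[s sK] := (generatesP (@mg_gen n M)).1 (@mg_genP n M).
have /choice[t tK] := (generatesP (@mg_gen n N)).1 (@mg_genP n N).
pose f x := free_eval (@mg_gen n N) (s x).
have fM : {morph f : x y / x * y}.
  move=> x y; rewrite /f -free_evalM; apply/MNE; rewrite free_evalM.
  by rewrite !sK.
pose f' : {multiplicative M -> N} := HB.pack f (isMultiplicative.Build M N f fM).
exists f'.
  exists (fun y => free_eval (@mg_gen n M) (t y)) => [x|y] /=.
    by rewrite -[RHS]sK; apply/MNE; rewrite tK.
  by rewrite /f -[RHS]tK; apply/MNE; rewrite sK.
move=> i /=; rewrite -[RHS]free_eval_gen; apply/MNE.
by rewrite sK free_eval_gen.
Qed.

Section QuotientGroup.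
Variables (F : groupType) (N : normal_subgroup F).

Let N1 : ns_set N 1. Proof. by have [[]] := ns_normal N. Qed.
Let NF x y : ns_set N x -> ns_set N y -> ns_set N (x / y).
Proof. by have [[_ H] _] := ns_normal N; apply: H. Qed.
Let NJ x y : ns_set N x -> ns_set N (x ^ y).
Proof. by have [_ H] := ns_normal N; move=> xN; apply: H. Qed.
Let NV x : ns_set N x -> ns_set N x^-1.
Proof. by move=> xN; rewrite -div1g NF. Qed.
Let NM x y : ns_set N x -> ns_set N y -> ns_set N (x * y).
Proof. by move=> xN yN; rewrite -[y]invgK NF// NV. Qed.

Definition ns_equiv (x y : F) : bool := ns_set N (x / y).

Fact ns_equiv_refl : reflexive ns_equiv.
Proof. by move=> x; rewrite /ns_equiv mulgV. Qed.
Fact ns_equiv_sym : symmetric ns_equiv.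
Proof.
by move=> x y; apply/idP/idP => /NV; rewrite /ns_equiv invgF.
Qed.
Fact ns_equiv_trans : transitive ns_equiv.
Proof.
by move=> y x z xy yz; have := NM xy yz; rewrite divgKA.
Qed.

Canonical ns_equiv_rel :=
  EquivRel ns_equiv ns_equiv_refl ns_equiv_sym ns_equiv_trans.

Definition ns_quotient := {eq_quot ns_equiv}.
HB.instance Definition _ := Choice.on ns_quotient.
HB.instance Definition _ := EqQuotient.on ns_quotient.

Local Notation proj := (\pi_ns_quotient).

Lemma ns_projP x y : proj x = proj y <-> ns_set N (x / y).
Proof. by split=> [/eqquotP|xy]//; apply/eqquotP. Qed.

Definition quo_mul (p q : ns_quotient) : ns_quotient := proj (repr p * repr q).
Definition quo_inv (p : ns_quotient) : ns_quotient := proj (repr p)^-1.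

Lemma quo_mulE x y : quo_mul (proj x) (proj y) = proj (x * y).
Proof.
have ex : ns_set N (repr (proj x) / x) by apply/ns_projP; rewrite reprK.
have ey : ns_set N (repr (proj y) / y) by apply/ns_projP; rewrite reprK.
apply/ns_projP; set u := repr _ in ex *; set v := repr _ in ey *.
suff -> : u * v / (x * y) = (v / y) ^ u^-1 * (u / x) by rewrite NM// NJ.
by rewrite conjgE invgK invgM !mulgA mulgVK.
Qed.

Lemma quo_invE x : quo_inv (proj x) = proj x^-1.
Proof.
have ex : ns_set N (repr (proj x) / x) by apply/ns_projP; rewrite reprK.
apply/ns_projP; set u := repr _ in ex *; rewrite invgK.
suff -> : u^-1 * x = ((u / x) ^ u)^-1 by rewrite NV// NJ.
by rewrite conjgE !invgM !invgK mulgA mulgVK.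
Qed.

Fact quo_mulA : associative quo_mul.
Proof.
elim/quotW=> x; elim/quotW=> y; elim/quotW=> z.
by rewrite (quo_mulE y z) (quo_mulE x y) (quo_mulE x) (quo_mulE _ z) mulgA.
Qed.
Fact quo_mul1 : left_id (proj 1) quo_mul.
Proof. by elim/quotW=> x; rewrite quo_mulE mul1g. Qed.
Fact quo_mulr1 : right_id (proj 1) quo_mul.
Proof. by elim/quotW=> x; rewrite quo_mulE mulg1. Qed.
Fact quo_mulV : left_inverse (proj 1) quo_inv quo_mul.
Proof. by elim/quotW=> x; rewrite quo_invE quo_mulE mulVg. Qed.
Fact quo_mulrV : right_inverse (proj 1) quo_inv quo_mul.
Proof. by elim/quotW=> x; rewrite quo_invE quo_mulE mulgV. Qed.

HB.instance Definition _ := isGroup.Build ns_quotient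
  quo_mulA quo_mul1 quo_mulr1 quo_mulV quo_mulrV.

Definition ns_proj (x : F) : ns_quotient := proj x.

Fact ns_projM : {morph ns_proj : x y / x * y}.
Proof. by move=> x y; rewrite /ns_proj -quo_mulE. Qed.
HB.instance Definition _ :=
  isMultiplicative.Build F ns_quotient ns_proj ns_projM.

Lemma ns_proj_eq1 x : (ns_proj x == 1) = ns_set N x.
Proof.
by apply/eqP/idP => [/ns_projP|Nx]; [|apply/ns_projP]; rewrite divg1.
Qed.

End QuotientGroup.

Section QuotientMarked.
Variables (n : nat) (N : normal_subgroup (free_group 'I_n)).

Let quotient_gen (i : 'I_n) : ns_quotient N := ns_proj N (free_gen i).

Let eval_quotient_gen w : free_eval quotient_gen w = ns_proj N w.
Proof. by rewrite -[w in RHS]free_eval_id morph_free_eval. Qed.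

Fact quotient_genP : generates quotient_gen.
Proof.
apply/generatesP => x; exists (repr x).
by rewrite eval_quotient_gen /ns_proj reprK.
Qed.

Definition quotient_marked : marked_group n := MarkedGroup quotient_genP.

Lemma mg_kernel_quotient : mg_kernel quotient_marked = N.
Proof.
apply/ns_set_inj/funext => w.
by rewrite mg_kernelE eval_quotient_gen ns_proj_eq1.
Qed.

End QuotientMarked.

(* The space G_n. A marked group, up to the identification [marked_iso], is
   represented by its kernel: by [mg_kernelP] and [mg_kernel_quotient],
   [mg_kernel] is a bijection from the n-generated marked groups so identified
   to the normal subgroups of F_n. *)
Definition ns_indicator n (N : normal_subgroup (free_group 'I_n)) :
  {ptws free_group 'I_n -> bool} := ns_set N.

Definition mg_space (n : nat) := initial_topology (@ns_indicator n).
HB.instance Definition _ (n : nat) := Topological.on (mg_space n).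

Definition mg_point n (M : marked_group n) : mg_space n := mg_kernel M.

(* The embedding (G, (a_1, ..., a_n)) |-> (G, (a_1, ..., a_n, 1)), see
   [stab_point]: on kernels, it is the preimage under the morphism
   F_(n+1) -> F_n that kills the last generator. *)
Definition extend1 n (G : groupType) (a : 'I_n -> G) (i : 'I_n.+1) : G :=
  if unlift ord_max i is Some j then a j else 1.

Definition stab n (p : mg_space n) : mg_space n.+1 :=
  preim_ns (free_eval (extend1 (@free_gen 'I_n))) p.

Lemma extend1_comp n (G H : groupType) (f : {multiplicative G -> H})
  (a : 'I_n -> G) : f \o extend1 a = extend1 (f \o a).
Proof.
by apply/funext => i; rewrite /= /extend1; case: unliftP => //=; rewrite morph1.
Qed.

Lemma free_eval_extend1 n (G : groupType) (a : 'I_n -> G) w :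
  free_eval a (free_eval (extend1 (@free_gen 'I_n)) w) = free_eval (extend1 a) w.
Proof.
rewrite morph_free_eval extend1_comp; congr (free_eval (extend1 _) _).
by apply/funext => i; apply: free_eval_gen.
Qed.

Lemma extend1_generates n (M : marked_group n) :
  generates (extend1 (@mg_gen n M)).
Proof.
move=> H HG aH; apply: (@mg_genP n M) => // i.
by have := aH (lift ord_max i); rewrite /extend1 liftK.
Qed.

Lemma stab_point n (M : marked_group n) :
  stab (mg_point M) = mg_point (MarkedGroup (@extend1_generates n M)).
Proof.
by apply/ns_set_inj/funext => w; rewrite mg_kernelE -free_eval_extend1.
Qed.

Lemma stab_inj n : injective (@stab n).
Proof.
move=> p q pq; apply/ns_set_inj/funext => w.
have -> : w = free_eval (extend1 (@free_gen 'I_n))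
                (free_eval (fun i => free_gen (lift ord_max i)) w).
  rewrite morph_free_eval -[LHS]free_eval_id; congr (free_eval _ _).
  by apply/funext => i; rewrite /= free_eval_gen /extend1 liftK.
exact: (congr1 (fun N => ns_set N _) pq).
Qed.

(* The union of the G_n: two points are identified when some iterates of the
   embeddings send them to the same point of the same G_k. *)
Definition step (P : {n : nat & mg_space n}) : {n : nat & mg_space n} :=
  Tagged mg_space (stab (tagged P)).

Definition union_equiv (P Q : {n : nat & mg_space n}) : bool :=
  `[< exists i j, iter i step P = iter j step Q >].

Fact union_equiv_refl : reflexive union_equiv.
Proof. by move=> P; apply/asboolP; exists 0%N, 0%N. Qed.
Fact union_equiv_sym : symmetric union_equiv.
Proof. by move=> P Q; apply/asboolP/asboolP => -[i [j ij]]; exists j, i. Qed.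
Fact union_equiv_trans : transitive union_equiv.
Proof.
move=> Q P R /asboolP[i [j PQ]] /asboolP[k [l QR]].
by apply/asboolP; exists (k + i)%N, (j + l)%N; rewrite !iterD PQ -QR -!iterD addnC.
Qed.

Canonical union_equiv_rel :=
  EquivRel union_equiv union_equiv_refl union_equiv_sym union_equiv_trans.

Definition mg_union := {eq_quot union_equiv}.
HB.instance Definition _ := Choice.on mg_union.
HB.instance Definition _ := EqQuotient.on mg_union.

Definition union_incl n (p : mg_space n) : mg_union :=
  \pi_mg_union (Tagged mg_space p).

Lemma union_incl_stab n (p : mg_space n) : union_incl (stab p) = union_incl p.
Proof. by apply/eqquotP/asboolP; exists 0%N, 1%N. Qed.

Lemma union_incl_inj n : injective (@union_incl n).
Proof.
move=> p q /eqquotP/asboolP[i [j]].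
have tag_iter k P : tag (iter k step P) = (k + tag P)%N.
  by elim: k => //= k ->.
have step_inj : injective step.
  move=> [m r] [m' r'] /[dup] /(congr1 tag) /= [mm'].
  case: m' / mm' r' => r' /eqP.
  by rewrite /step eq_Tagged /= => /eqP/stab_inj ->.
move=> /[dup] /(congr1 tag); rewrite !tag_iter /= => /addIn ->.
elim: j => [/eqP|j IHj /step_inj//]; by rewrite eq_Tagged => /eqP.
Qed.

(* The topological union topology. *)
Definition union_open (U : set mg_union) : Prop :=
  forall n, open (@union_incl n @^-1` U).

Fact union_openT : union_open setT.
Proof. by move=> n; rewrite preimage_setT; exact: openT. Qed.
Fact union_openI : setI_closed union_open.
Proof. by move=> U V oU oV n; rewrite preimage_setI; exact: openI. Qed.
Fact union_open_bigU (I : Type) (f : I -> set mg_union) :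
  (forall i, union_open (f i)) -> union_open (\bigcup_i f i).
Proof.
by move=> oF n; rewrite preimage_bigcup; apply: bigcup_open => i _; apply: oF.
Qed.

HB.instance Definition _ :=
  isOpenTopological.Build mg_union union_openT union_openI union_open_bigU.

Definition iso_class (G : groupType) : set mg_union :=
  [set p | exists n (M : marked_group n), isomorphic M G /\ p = union_incl (mg_point M)].

Definition condensed (G : groupType) : Prop :=
  finitely_generated G /\ isolated (iso_class G) = set0.

(* The restricted wreath product A wr B: pairs of a finitely supported function
   B -> A and an element of B, where b acts on f by (b f)(x) = f (b^-1 x). *)
Section Wreath.
Variables A B : groupType.

Definition wreath : Type := ({fsfun B -> A with 1} * B)%type.
HB.instance Definition _ := Choice.on wreath.

Definition wr_act (b : B) (f : {fsfun B -> A with 1}) : {fsfun B -> A with 1} :=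
  [fsfun x in [fset b * y | y in finsupp f]%fset => f (b^-1 * x)].

Definition wr_base_mul (f g : {fsfun B -> A with 1}) : {fsfun B -> A with 1} :=
  [fsfun x in (finsupp f `|` finsupp g)%fset => f x * g x].

Definition wr_base_inv (f : {fsfun B -> A with 1}) : {fsfun B -> A with 1} :=
  [fsfun x in finsupp f => (f x)^-1].

Lemma wr_actE b f x : wr_act b f x = f (b^-1 * x).
Proof.
rewrite fsfun_fun; case: ifPn => // /imfsetP xb; apply/esym/fsfun_dflt.
by apply/negP => xf; apply: xb; exists (b^-1 * x) => //; rewrite mulVKg.
Qed.

Lemma wr_base_mulE f g x : wr_base_mul f g x = f x * g x.
Proof.
rewrite fsfun_fun inE; case: ifPn => //; rewrite negb_or => /andP[xf xg].
by rewrite !fsfun_dflt// mulg1.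
Qed.

Lemma wr_base_invE f x : wr_base_inv f x = (f x)^-1.
Proof. by rewrite fsfun_fun; case: finsuppP; rewrite ?invg1. Qed.

Definition wr_one : wreath := ([fsfun with 1], 1).
Definition wr_mul (u v : wreath) : wreath :=
  (wr_base_mul u.1 (wr_act u.2 v.1), u.2 * v.2).
Definition wr_inv (u : wreath) : wreath :=
  (wr_act u.2^-1 (wr_base_inv u.1), u.2^-1).

Definition wrE :=
  (wr_base_mulE, wr_actE, wr_base_invE, @fsfun0E).

Fact wr_mulA : associative wr_mul.
Proof.
move=> u v w; congr (_, _); last exact: mulgA.
by apply/fsfunP => x; rewrite /= !wrE mulgA invgM mulgA.
Qed.
Fact wr_mul1 : left_id wr_one wr_mul.
Proof.
case=> f b; congr (_, _); last exact: mul1g.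
by apply/fsfunP => x; rewrite /= !wrE mul1g invg1 mul1g.
Qed.
Fact wr_mulr1 : right_id wr_one wr_mul.
Proof.
case=> f b; congr (_, _); last exact: mulg1.
by apply/fsfunP => x; rewrite /= !wrE mulg1.
Qed.
Fact wr_mulV : left_inverse wr_one wr_inv wr_mul.
Proof.
move=> u; congr (_, _); last exact: mulVg.
by apply/fsfunP => x; rewrite /= !wrE mulVg.
Qed.
Fact wr_mulrV : right_inverse wr_one wr_inv wr_mul.
Proof.
move=> u; congr (_, _); last exact: mulgV.
by apply/fsfunP => x; rewrite /= !wrE invgK mulVKg mulgV.
Qed.

HB.instance Definition _ :=
  isGroup.Build wreath wr_mulA wr_mul1 wr_mulr1 wr_mulV wr_mulrV.

End Wreath.

(* 1 -> A -> G -> Q -> 1 is exact with central image of A. *)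
Definition central_extension (A G Q : groupType) : Prop :=
  exists (i : {multiplicative A -> G}) (p : {multiplicative G -> Q}),
    [/\ injective i, forall q, exists g, p g = q,
        forall g, p g = 1 <-> exists a, i a = g &
        forall a g, commute (i a) g].

(* Main.v *)
Require Import Defs.
From HB Require Import structures.
From mathcomp Require Import all_boot all_order all_algebra.
From mathcomp Require Import finmap.
From mathcomp Require Import boolp classical_sets topology.

(** Let H be the group with generators a_i, b_i (i an integer) and z, where z is
    central with z ^ 2 = 1, [b_i, a_i] = z for all i, and all other pairs of
    generators commute. Let the infinite cyclic group generated by t shift the
    indices. The group G = <a_0, b_0, t> so obtained is a central extension of
    Z^2 wr Z by the group {1, z}. It is built below from the cocycle
    c(f s, g t) = beta(f, s g), where beta(f, g) is the sum over x of
    f(x)_2 g(x)_1 modulo 2 ([mod2_form], [wr_cocycle]).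

    The substitution a_0 |-> a_0 b_n, b_0 |-> b_0, t |-> t induces, for each n, an
    automorphism of Z^2 wr Z. For n > 0 it does not lift to G: a_0 and a_n
    commute, but their images a_0 b_n and a_n b_2n do not, because of the pair
    b_n, a_n ([almost_aut_not_extendable]). The failure is however located at
    distance n: for fixed u and v in Z^2 wr Z the cocycle takes the same value on
    (u, v) and on their images as soon as n is large. Hence the bijection
    psi_n = id x (automorphism) of the set Z_2 x (Z^2 wr Z) respects any given
    product of G for all large n ([near_almost_autM]).

    Such a sequence of almost automorphisms shows that G is condensed, whatever
    the marking B of G ([condensed_almost_automorphisms]): any relation between
    the entries of B holds between those of psi_n(B) for large n and conversely,
    so the markings psi_n(B) converge to B; if one of them with n large were
    equivalent to B, then psi_n would coincide on the generators a_0, b_0, t with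
    an automorphism of G. *)

Set Implicit Arguments.
Unset Strict Implicit.
Unset Printing Implicit Defensive.

Local Open Scope classical_set_scope.
Local Open Scope group_scope.
Import GRing.Theory.

(** * Markings of a group and their limits *)

Section IsoClass.
Variable G : groupType.

Definition gen_point m (B : 'I_m -> G) (genB : generates B) : mg_space m :=
  mg_point (MarkedGroup genB).

(** Transporting the generators along the isomorphism puts every point of the
    isomorphism class on the group G itself, so that limits can be taken by
    moving only the generating tuple. *)
Lemma iso_classP p : iso_class G p <->
  exists m (B : 'I_m -> G) (genB : generates B),
    p = union_incl (gen_point genB).
Proof.
split=> [[m [M [[f fbij] ->]]]|[m [B [genB ->]]]]; last first.
  exists m, (MarkedGroup genB); split=> //.
  by exists (idfun : {multiplicative G -> G}); exists idfun.
have genB : generates (f \o @mg_gen m M).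
  apply/generatesP => x; have [g fK gK] := fbij.
  have [w wx] := (generatesP _).1 (@mg_genP m M) (g x).
  by exists w; rewrite -morph_free_eval wx gK.
exists m, (f \o @mg_gen m M), genB; congr union_incl.
by apply/mg_kernelP; exists f.
Qed.

(** Convergence in the space of marked groups is pointwise convergence of the
    kernels. The tuples [B n] need not generate: being a
    generating tuple matters only for naming a point of the space, whence the
    quantifier over [genB] inside the filter. *)
Lemma cvg_gen_point m (B : nat -> 'I_m -> G) (B0 : 'I_m -> G)
    (gen0 : generates B0) (U : set mg_union) :
  (forall w, \forall n \near \oo,
     (free_eval (B n) w == 1) = (free_eval B0 w == 1)) ->
  nbhs (union_incl (gen_point gen0)) U ->
  \forall n \near \oo, forall genB : generates (B n),
    U (union_incl (gen_point genB)).
Proof.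
move=> BB0; rewrite nbhsE => -[V [/(_ m) [A oA AV] V0] VU].
pose N C : {ptws free_group 'I_m -> bool} := fun w => free_eval C w == 1 :> G.
have cvgN : (N \o B) n @[n --> \oo] --> N B0.
  apply/cvg_sup => w W' [_ [[W _ <-] /= WB0] WW'].
  by apply: filterS (BB0 w) => n /= e; apply: WW'; rewrite /= /N e.
have : nbhs (N B0) A.
  apply: open_nbhs_nbhs; split=> //.
  by have : (@union_incl m @^-1` V) (gen_point gen0) by []; rewrite -AV.
move/cvgN => NA; near=> n.
have An : A (N (B n)) by near: n.
move=> genB; apply: VU.
suff : (@union_incl m @^-1` V) (gen_point genB) by [].
by rewrite -AV.
Unshelve. all: by end_near. Qed.

End IsoClass.

(** * Almost automorphisms *)

Section AlmostAutomorphisms.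
Variables (G : groupType) (psi : nat -> G -> G).
Hypothesis psiM : forall g h,
  \forall n \near \oo, psi n (g * h) = psi n g * psi n h.
Hypothesis psi_inj : forall n, injective (psi n).

Lemma near_morph1 : \forall n \near \oo, psi n 1 = 1.
Proof.
by apply: filterS (psiM 1 1) => n; rewrite mulg1 -{1}[psi n 1]mulg1 => /mulgI.
Qed.

Lemma near_morphV g : \forall n \near \oo, psi n g^-1 = (psi n g)^-1.
Proof.
apply: filterS2 near_morph1 (psiM g g^-1) => n psi1.
by rewrite mulgV psi1 => e; apply: (mulgI (psi n g)); rewrite -e mulgV.
Qed.

(** A word involves finitely many products, and each of them is respected for
    all large n. *)
Lemma near_morph_eval (X : choiceType) (B : X -> G) (w : free_group X) :
  \forall n \near \oo, free_eval (psi n \o B) w = psi n (free_eval B w).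
Proof.
rewrite /free_eval; elim: (val w) => [|l s IHs].
  by apply: filterS near_morph1 => n; rewrite !big_nil.
have eval_l : \forall n \near \oo,
    eval_letter (psi n \o B) l = psi n (eval_letter B l).
  case: l => x [] /=; last by apply: filterE.
  by apply: filterS (near_morphV (B x)) => n; rewrite /eval_letter.
have := psiM (eval_letter B l) (\prod_(m <- s) eval_letter B m).
apply: filterS3 eval_l IHs.
by move=> n; rewrite !big_cons => -> -> ->.
Qed.

(** One good generating tuple S takes care of all markings B, because S is
    expressed by words in B, and these words are respected for large n: hence
    psi_n(B) generates as soon as psi_n(S) does, and an isomorphism that maps
    B to psi_n(B) would map S to psi_n(S). *)
Theorem condensed_almost_automorphisms k (S : 'I_k -> G) :
  generates S ->
  (\forall n \near \oo, generates (psi n \o S)) ->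
  (\forall n \near \oo, forall f : {multiplicative G -> G},
     ~ (forall i, f (S i) = psi n (S i))) ->
  condensed G.
Proof.
move=> genS genpsi psi_ext; split; first by exists k, S.
rewrite eqEsubset; split=> // p.
move=> [/set_mem /iso_classP[m [B [genB ->]]] [V Vp Veq]].
have near_ker w : \forall n \near \oo,
    (free_eval (psi n \o B) w == 1) = (free_eval B w == 1).
  apply: filterS2 near_morph1 (near_morph_eval B w) => n psi1 ->.
  by rewrite -{1}psi1 (inj_eq (@psi_inj n)).
have /choice[v vS] i : exists v, free_eval B v = S i by apply/(generatesP B).1.
have near_v : \forall n \near \oo, forall i,
    free_eval (psi n \o B) (v i) = psi n (S i).
  by apply: filter_forall => i; rewrite -vS; apply: near_morph_eval.
have [n [[[psiS ext_n] v_n] V_n]] := filter_ex (filterI (filterI (filterI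
  genpsi psi_ext) near_v) (cvg_gen_point near_ker Vp)).
have genBn : generates (psi n \o B).
  move=> H HG BH; apply: psiS => // i /=; rewrite -v_n.
  rewrite /free_eval; elim/big_ind: _ => [||[x []] _]; first by case: HG.
  - exact: group_closedM HG.
  - exact: group_closedV HG _ (BH x).
  - exact: BH.
have : (V `&` iso_class G) (union_incl (gen_point genBn)).
  by split; [exact: V_n|apply/iso_classP; exists m, (psi n \o B), genBn].
rewrite Veq => /union_incl_inj/esym/mg_kernelP[/= f _ fB].
apply: (ext_n f) => i; rewrite -v_n -vS morph_free_eval.
by congr (free_eval _ _); apply/funext => j; apply: fB.
Qed.

End AlmostAutomorphisms.

(** * Central extensions from cocycles *)

Section CocycleExtension.
Variables (A : zmodType) (Q : groupType) (c : Q -> Q -> A).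

Definition normalized_cocycle : Prop :=
  (forall u v w, c u v + c (u * v) w = c v w + c u (v * w))%R /\ c 1 1 = 0%R.

(** The proof of the cocycle law is an argument of the type so that the group
    structure, which depends on it, can be inferred from the type. *)
Definition cocycle_ext of normalized_cocycle : Type := (A * Q)%type.

Variable hc : normalized_cocycle.
Local Notation E := (cocycle_ext hc).

HB.instance Definition _ := Choice.copy E (A * Q)%type.

Definition ext_pair (e : A) (u : Q) : E := (e, u).

Fact cocycle1g u : c 1 u = 0%R.
Proof.
have := hc.1 1 1 u; rewrite !mul1g hc.2 => /(congr1 (fun x => x - c 1 u)%R).
by rewrite add0r subrr addrK.
Qed.

Fact cocycleg1 u : c u 1 = 0%R.
Proof.
have := hc.1 u 1 1; rewrite !mulg1 hc.2 => /(congr1 (fun x => x - c u 1)%R).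
by rewrite add0r subrr addrK.
Qed.

Fact cocyclegV u : c u u^-1 = c u^-1 u.
Proof.
by have := hc.1 u u^-1 u; rewrite mulgV mulVg cocycle1g cocycleg1 !addr0.
Qed.

Definition ext_one : E := ext_pair 0%R 1.
Definition ext_mul (g h : E) : E :=
  ext_pair (g.1 + h.1 + c g.2 h.2)%R (g.2 * h.2).
Definition ext_inv (g : E) : E := ext_pair (- (g.1 + c g.2^-1 g.2))%R g.2^-1.

Fact ext_mulA : associative ext_mul.
Proof.
case=> [e u] [f v] [k w]; congr (_, _); rewrite /= ?mulgA//.
rewrite -!addrA; congr (_ + (_ + _))%R.
by rewrite [RHS]addrCA hc.1.
Qed.
Fact ext_mul1 : left_id ext_one ext_mul.
Proof.
by case=> e u; congr (_, _); rewrite /= ?mul1g// cocycle1g add0r addr0.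
Qed.
Fact ext_mulr1 : right_id ext_one ext_mul.
Proof. by case=> e u; congr (_, _); rewrite /= ?mulg1// cocycleg1 !addr0. Qed.
Fact ext_mulV : left_inverse ext_one ext_inv ext_mul.
Proof.
by case=> e u; congr (_, _); rewrite /= ?mulVg// -addrA addNr.
Qed.
Fact ext_mulrV : right_inverse ext_one ext_inv ext_mul.
Proof.
by case=> e u; congr (_, _); rewrite /= ?mulgV// cocyclegV addrAC subrr.
Qed.

HB.instance Definition _ := isGroup.Build E
  ext_mulA ext_mul1 ext_mulr1 ext_mulV ext_mulrV.

Lemma ext_mulE e f u v :
  ext_pair e u * ext_pair f v = ext_pair (e + f + c u v)%R (u * v).
Proof. by []. Qed.

Lemma ext_centralE e f u : ext_pair e 1 * ext_pair f u = ext_pair (e + f)%R u.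
Proof. by rewrite ext_mulE mul1g cocycle1g addr0. Qed.

Lemma cocycle_central_extension :
  central_extension (Algebra.to_multiplicative A) E Q.
Proof.
pose i (e : Algebra.to_multiplicative A) := ext_pair e 1.
have iM : {morph i : e f / e * f} by move=> e f; rewrite /i ext_centralE.
pose p (g : E) := g.2.
have pM : {morph p : g h / g * h} by [].
pose i' : {multiplicative _ -> _} :=
  HB.pack i (isMultiplicative.Build _ _ i iM).
pose p' : {multiplicative _ -> _} :=
  HB.pack p (isMultiplicative.Build _ _ p pM).
exists i', p'.
split=> /= [e f [] //|q|g|e g].
- by exists (ext_pair 0%R q).
- by case: g => e u; split=> [/= ->|[f [_ <-]]//]; exists e.
- case: g => f u; rewrite /commute ext_centralE ext_mulE.
  by rewrite mulg1 cocycleg1 addr0 addrC.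
Qed.

End CocycleExtension.

(** * Generation of wreath products *)

Section WreathGeneration.
Variables A B : groupType.
Local Notation base := {fsfun B -> A with 1}.

Definition wr_delta (x : B) (v : A) : base := [fsfun y in [fset x]%fset => v].

Lemma wr_deltaE x v y : wr_delta x v y = if y == x then v else 1.
Proof. by rewrite fsfun_fun inE. Qed.

Lemma wr_act_delta b x v : wr_act b (wr_delta x v) = wr_delta (b * x) v.
Proof.
apply/fsfunP => y; rewrite wr_actE !wr_deltaE.
by rewrite -(inj_eq (mulgI b)) mulVKg.
Qed.

Lemma wr_act_one b : wr_act b [fsfun with 1] = [fsfun with 1] :> base.
Proof. by apply/fsfunP => y; rewrite !wrE. Qed.

Lemma wr_base_mul1 (f : base) : wr_base_mul f [fsfun with 1] = f.
Proof. by apply/fsfunP => y; rewrite !wrE mulg1. Qed.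

Lemma wr_base_1mul (f : base) : wr_base_mul [fsfun with 1] f = f.
Proof. by apply/fsfunP => y; rewrite !wrE mul1g. Qed.

Lemma wr_act1 (f : base) : wr_act 1 f = f.
Proof. by apply/fsfunP => y; rewrite !wrE invg1 mul1g. Qed.

Lemma wr_actA b b' (f : base) : wr_act b (wr_act b' f) = wr_act (b * b') f.
Proof. by apply/fsfunP => y; rewrite !wrE invgM mulgA. Qed.

Lemma wr_act_mul b (f g : base) :
  wr_act b (wr_base_mul f g) = wr_base_mul (wr_act b f) (wr_act b g).
Proof. by apply/fsfunP => y; rewrite !wrE. Qed.

Definition wr_bot (f : base) : wreath A B := (f, 1).
Definition wr_top (b : B) : wreath A B := ([fsfun with 1], b).

Lemma wr_mulE (u v : wreath A B) :
  u * v = (wr_base_mul u.1 (wr_act u.2 v.1), u.2 * v.2).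
Proof. by []. Qed.

(** Conjugating by the top group moves the copy of A at 1 to any other place,
    and an element of the base group is the product of its finitely many
    nontrivial values. *)
Lemma wreath_closed_full (H : {pred wreath A B}) : group_closed H ->
  (forall v, wr_bot (wr_delta 1 v) \in H) -> (forall b, wr_top b \in H) ->
  forall w, w \in H.
Proof.
move=> HG Hv Hb; have HM := group_closedM HG; have HV := group_closedV HG.
have Hx x v : wr_bot (wr_delta x v) \in H.
  suff -> : wr_bot (wr_delta x v) =
      wr_top x * wr_bot (wr_delta 1 v) * wr_top x^-1.
    by rewrite !HM.
  rewrite !wr_mulE /= wr_act_one wr_base_mul1 wr_base_1mul wr_act_delta !mulg1.
  by rewrite mulgV.
have Hf f : wr_bot f \in H.
  have [n] := ubnP #|` finsupp f|%fset.
  elim: n f => // n IHn f.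
  have [f0 _|[x xf]] := fset_0Vmem (finsupp f).
    suff -> : wr_bot f = 1 by case: HG.
    congr (_, _); apply/fsfunP => y.
    by rewrite fsfun0E fsfun_dflt // f0.
  rewrite ltnS (cardfsD1 x) xf => lef.
  pose f' := [fsfun f without x]%fset.
  suff -> : wr_bot f = wr_bot (wr_delta x (f x)) * wr_bot f'.
    by rewrite HM ?Hx// IHn// finsupp_without.
  rewrite wr_mulE /= mulg1 wr_act1; congr (_, _); apply/fsfunP => y.
  rewrite wr_base_mulE wr_deltaE fsfun_withE.
  by case: eqP => [->|]; rewrite ?mulg1 ?mul1g.
move=> [f b]; suff -> : (f, b) = wr_bot f * wr_top b by rewrite HM.
by rewrite wr_mulE /= wr_act1 wr_base_mul1 mul1g.
Qed.

End WreathGeneration.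

(** * The mod 2 form on the base of Z^2 wr Z and its cocycle *)

Local Notation Z := (Algebra.to_multiplicative int).
Local Notation Z2 := (Z * Z)%type.
Local Notation base := {fsfun Z -> Z2 with 1}.
Local Notation W := (wreath Z2 Z).

Lemma int_closed_full (H : {pred Z}) :
  group_closed H -> (1%R : Z) \in H -> forall z, z \in H.
Proof.
move=> HG H1.
have HN (n : nat) : (Posz n : Z) \in H.
  elim: n => [|n IHn]; first by case: HG.
  by have := group_closedM HG H1 IHn.
case=> n; first exact: HN.
by rewrite NegzE; exact: group_closedV HG _ (HN n.+1).
Qed.

Definition parity (z : Z) : 'Z_2 := (z : int)%:~R%R.

Lemma parityM x y : parity (x * y) = (parity x + parity y)%R.
Proof. exact: rmorphD. Qed.

Lemma parity1g : parity 1 = 0%R. Proof. by []. Qed.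

(** A non-symmetric bilinear form: only its antisymmetrization, in which the
    two coordinates at the same place are paired, shows up in the commutators
    of the extension. *)
Definition mod2_form (f g : base) : 'Z_2 :=
  (\sum_(x <- finsupp f) parity (f x).2 * parity (g x).1)%R.

Lemma mod2_form_incl (S : {fset Z}) f g : (finsupp f `<=` S)%fset ->
  mod2_form f g = (\sum_(x <- S) parity (f x).2 * parity (g x).1)%R.
Proof.
move=> fS; apply: big_fset_incl fS _ => x _ xf.
by rewrite fsfun_dflt // parity1g mul0r.
Qed.

Lemma mod2_form_mull (f f' g : base) :
  mod2_form (wr_base_mul f f') g = (mod2_form f g + mod2_form f' g)%R.
Proof.
pose S := (finsupp f `|` finsupp f' `|` finsupp (wr_base_mul f f'))%fset.
rewrite !(@mod2_form_incl S);
  do ?by apply/fsubsetP => x; rewrite !inE => ->; rewrite ?orbT.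
by rewrite -big_split; apply: eq_bigr => x _; rewrite wrE parityM mulrDl.
Qed.

Lemma mod2_form_mulr (f g g' : base) :
  mod2_form f (wr_base_mul g g') = (mod2_form f g + mod2_form f g')%R.
Proof.
by rewrite -big_split; apply: eq_bigr => x _; rewrite wrE parityM mulrDr.
Qed.

Lemma mod2_form_eqr (f g g' : base) :
  (forall x, (g x).1 = (g' x).1) -> mod2_form f g = mod2_form f g'.
Proof. by move=> gg'; apply: eq_bigr => x _; rewrite gg'. Qed.

Lemma mod2_form_eq0 (f g : base) :
  (forall x, (f x).2 = 1 \/ (g x).1 = 1) -> mod2_form f g = 0%R.
Proof.
move=> fg; apply: big1 => x _.
by case: (fg x) => ->; rewrite parity1g (mul0r, mulr0).
Qed.

Lemma mod2_form_act b f g : mod2_form (wr_act b f) (wr_act b g) = mod2_form f g.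
Proof.
rewrite (@mod2_form_incl [fset b * y | y in finsupp f]%fset); last first.
  apply/fsubsetP => x; rewrite mem_finsupp wr_actE -mem_finsupp => xf.
  by apply/imfsetP; exists (b^-1 * x); rewrite ?mulVKg.
rewrite big_imfset /=; last by move=> x y _ _; apply: mulgI.
by apply: eq_bigr => x _; rewrite !wr_actE mulKg.
Qed.

Lemma mod2_form_delta x v g :
  mod2_form (wr_delta x v) g = (parity v.2 * parity (g x).1)%R.
Proof.
rewrite (@mod2_form_incl [fset x]%fset); last first.
  apply/fsubsetP => y; rewrite mem_finsupp wr_deltaE inE.
  by case: ifP => //; rewrite eqxx.
by rewrite big_seq_fset1 wr_deltaE eqxx.
Qed.

Definition wr_cocycle (u v : W) : 'Z_2 := mod2_form u.1 (wr_act u.2 v.1).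

(** The cocycle law is the bilinearity of the form together with its invariance
    under translations. *)
Fact wr_cocycleP : normalized_cocycle wr_cocycle.
Proof.
split=> [u v w|]; last by apply: mod2_form_eq0 => x; left; rewrite fsfun0E.
rewrite /wr_cocycle /= mod2_form_mull wr_act_mul mod2_form_mulr wr_actA.
by rewrite -(mod2_form_act u.2 v.1) wr_actA [RHS]addrC addrA.
Qed.

(** * The extension of Z^2 wr Z and its generators *)

Local Notation TW := (cocycle_ext wr_cocycleP).
Local Notation epair := (ext_pair wr_cocycleP).

(** On the base this section of the projection is not a morphism: [ext_botM]
    shows the form as the defect. *)
Definition ext_bot (f : base) : TW := epair 0%R (wr_bot f).
Definition ext_top (b : Z) : TW := epair 0%R (wr_top Z2 b).

Lemma ext_botM f g :
  ext_bot f * ext_bot g = epair (mod2_form f g) (wr_bot (wr_base_mul f g)).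
Proof.
by rewrite /ext_bot ext_mulE /wr_cocycle wr_mulE /= wr_act1 !add0r mulg1.
Qed.

Lemma ext_botM0 f g : mod2_form f g = 0%R ->
  ext_bot f * ext_bot g = ext_bot (wr_base_mul f g).
Proof. by rewrite ext_botM => ->. Qed.

Lemma ext_topM b b' : ext_top b * ext_top b' = ext_top (b * b').
Proof.
rewrite /ext_top ext_mulE wr_mulE /wr_cocycle /= wr_act_one wr_base_mul1.
by rewrite mod2_form_eq0 ?addr0 // => x; left; rewrite fsfun0E.
Qed.

Lemma ext_botJ b f :
  ext_top b * ext_bot f * (ext_top b)^-1 = ext_bot (wr_act b f).
Proof.
apply: (canLR (mulgK _)).
rewrite /ext_top /ext_bot !ext_mulE !wr_mulE /wr_cocycle /=.
rewrite !(wr_act1, mulg1, mul1g) wr_base_1mul wr_base_mul1.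
by rewrite !mod2_form_eq0 ?addr0 // => x; rewrite fsfun0E; [right|left].
Qed.

Lemma ext_topX n : ext_top (Posz n) = ext_top (1%R : Z) ^+ n.
Proof.
elim: n => [//|n IHn]; rewrite expgS -IHn ext_topM.
by congr ext_top; rewrite -add1n PoszD.
Qed.

Definition base_a : base := wr_delta (1 : Z) ((1%R : Z, 1) : Z2).
Definition base_b : base := wr_delta (1 : Z) ((1, 1%R : Z) : Z2).

(** The central element is the commutator of the two base generators, so that
    generation can be tested in the quotient Z^2 wr Z. *)
Lemma twisted_closed_full (H : {pred TW}) : group_closed H ->
  ext_bot base_a \in H -> ext_bot base_b \in H -> ext_top (1%R : Z) \in H ->
  forall g, g \in H.
Proof.
move=> HG Ha Hb Ht; have [H1 HD] := HG.
have HM := group_closedM HG; have HV := group_closedV HG.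
have fullZ (f : Z -> TW) : {morph f : x y / x * y} -> f (1%R : Z) \in H ->
    forall z, f z \in H.
  move=> fM Hf z; pose f' : {multiplicative Z -> TW} :=
    HB.pack f (isMultiplicative.Build _ _ f fM).
  apply: (@int_closed_full [pred x | f' x \in H]) => //; split.
    by change (f' 1 \in H); rewrite morph1.
  move=> x y Hx Hy; change (f' (x / y) \in H).
  by rewrite gmulfM morphV HD.
have Htop b : ext_top b \in H by apply: fullZ => // x y; rewrite ext_topM.
have Hdelta1 v : ext_bot (wr_delta (1 : Z) v) \in H.
  have -> : ext_bot (wr_delta (1 : Z) v) =
      ext_bot (wr_delta (1 : Z) ((v.1, 1) : Z2)) *
      ext_bot (wr_delta (1 : Z) ((1, v.2) : Z2)).
    rewrite ext_botM0 ?mod2_form_delta ?mul0r//; congr ext_bot.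
    apply/fsfunP => x.
    rewrite !wrE !wr_deltaE; case: ifP => _; last by rewrite mulg1.
    by case: v => v w; congr (_, _); rewrite (mulg1, mul1g).
  apply: HM.
    apply: (fullZ (fun z => ext_bot (wr_delta (1 : Z) ((z, 1) : Z2)))) => // x y.
    rewrite ext_botM0 ?mod2_form_delta ?mul0r//; congr ext_bot.
    apply/fsfunP => z.
    by rewrite !wrE !wr_deltaE; case: ifP => _; rewrite ?mulg1.
  apply: (fullZ (fun z => ext_bot (wr_delta (1 : Z) ((1, z) : Z2)))) => // x y.
  rewrite ext_botM0 ?mod2_form_delta ?wr_deltaE ?eqxx ?mulr0//; congr ext_bot.
  by apply/fsfunP => z; rewrite !wrE !wr_deltaE; case: ifP => _; rewrite ?mulg1.
have Hz : epair 1%R 1 \in H.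
  suff -> : epair 1%R 1 =
      ext_bot base_b * ext_bot base_a / (ext_bot base_a * ext_bot base_b).
    by rewrite HD ?HM.
  apply: canRL (mulgK _) _; rewrite !ext_botM ext_centralE !mod2_form_delta.
  rewrite /base_a /base_b !wr_deltaE eqxx /= mul0r mulr1 addr0.
  congr (epair _ (wr_bot _)); apply/fsfunP => z.
  by rewrite !wrE !wr_deltaE; case: ifP => _; rewrite ?mulg1.
have Hcentral (e : 'Z_2) : epair e 1 \in H.
  case: e => [[|[|//]] lt]; last by congr (epair _ _ \in H): Hz; apply: val_inj.
  have -> : epair (Ordinal lt) 1 = 1 by congr (_, _); apply: val_inj.
  exact: H1.
suff Hw w : epair 0%R w \in H.
  by case=> e w; rewrite -[(e, w)]/(epair e w) -[e]addr0 -ext_centralE HM.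
apply: (@wreath_closed_full _ _ [pred w | epair 0%R w \in H]) => //.
split; first by rewrite inE.
move=> u v; rewrite !inE => Hu Hv.
pose g := epair 0%R u / epair 0%R v.
have -> : epair 0%R (u / v) = epair (- g.1)%R 1 * g.
  by rewrite -[g in RHS]/(epair g.1 g.2) ext_centralE addNr.
by rewrite HM ?HD.
Qed.

(** * Almost automorphisms of the extension *)

Lemma mulZC (x y : Z) : x * y = y * x.
Proof. exact: addrC. Qed.

Definition fst_to_snd (f : base) : base :=
  [fsfun x in finsupp f => ((1, (f x).1) : Z2)].

Lemma fst_to_sndE f x : fst_to_snd f x = (1, (f x).1).
Proof. by rewrite fsfun_fun; case: finsuppP. Qed.

(** The automorphism a_x |-> a_x b_(x+n), b_x |-> b_x of the base; as the shift
    by n commutes with all shifts, it extends to Z^2 wr Z. *)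
Definition shear (n : nat) (f : base) : base :=
  wr_base_mul f (wr_act (Posz n : Z) (fst_to_snd f)).

Lemma shearE n f x :
  shear n f x = ((f x).1, (f x).2 * (f ((Posz n : Z)^-1 * x)).1).
Proof. by rewrite !wrE fst_to_sndE; congr (_, _); rewrite /= mulg1. Qed.

Lemma shear_mul n f g :
  shear n (wr_base_mul f g) = wr_base_mul (shear n f) (shear n g).
Proof.
apply/fsfunP => x.
rewrite shearE !(wr_base_mulE f g) (wr_base_mulE (shear n f)) !shearE.
by congr (_, _); apply: (@addrACA int).
Qed.

Lemma shear_act n b f : shear n (wr_act b f) = wr_act b (shear n f).
Proof.
apply/fsfunP => x; rewrite !(wr_actE, shearE) !mulgA.
by rewrite (mulZC (Posz n : Z)^-1 b^-1).
Qed.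

Lemma shear_inj n : injective (shear n).
Proof.
move=> f g fg; have e x := congr1 (fun h : base => h x) fg.
have e1 x : (f x).1 = (g x).1 by have := e x; rewrite !shearE => -[].
apply/fsfunP => x; rewrite [f x]surjective_pairing [g x]surjective_pairing e1.
by have := congr1 snd (e x); rewrite !shearE /= e1 => /mulIg ->.
Qed.

Lemma near_shift (f : base) (x : Z) :
  \forall n \near \oo, f ((Posz n : Z)^-1 * x) = 1.
Proof.
pose dist (y : Z) := absz ((x : int) - y)%R.
exists (\max_(y <- finsupp f) dist y).+1 => // n /= lt_n.
apply/fsfun_dflt/negP => nf.
have dist_n : dist ((Posz n : Z)^-1 * x) = n.
  by rewrite /dist (_ : (_ - _)%R = Posz n) // opprD opprK addrC addrNK.
by have := @leq_bigmax_seq _ _ xpredT dist _ nf isT; rewrite dist_n leqNgt lt_n.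
Qed.

(** Two finite supports become disjoint once one of them is shifted far away. *)
Lemma near_mod2_form0 (f g : base) :
  \forall n \near \oo, mod2_form (wr_act (Posz n : Z) f) g = 0%R.
Proof.
have : \forall n \near \oo,
    forall x : finsupp g, f ((Posz n : Z)^-1 * val x) = 1.
  by apply: filter_forall => x; apply: near_shift.
apply: filterS => n fn; apply: mod2_form_eq0 => x.
case: (finsuppP g x) => [|xg]; first by right.
by left; rewrite wr_actE (fn [` xg]%fset).
Qed.

Definition almost_aut (n : nat) (g : TW) : TW :=
  epair g.1 (shear n g.2.1, g.2.2).

Lemma almost_aut_bot n f : almost_aut n (ext_bot f) = ext_bot (shear n f).
Proof. by []. Qed.

Lemma almost_aut_top n b : almost_aut n (ext_top b) = ext_top b.
Proof.
congr (epair _ (_, _)); apply/fsfunP => x.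
by rewrite shearE !fsfun0E mulg1.
Qed.

Lemma almost_aut_inj n : injective (almost_aut n).
Proof. by case=> e [f b] [e' [f' b']] [-> /shear_inj -> ->]. Qed.

(** The defect is the form of the shifted part of the sheared left factor with
    the right one: the form only sees second coordinates on the left and first
    coordinates on the right, and shearing keeps the latter. *)
Lemma near_almost_autM g h : \forall n \near \oo,
  almost_aut n (g * h) = almost_aut n g * almost_aut n h.
Proof.
case: g h => [e [f b]] [e' [f' b']].
apply: filterS (near_mod2_form0 (fst_to_snd f) (wr_act b f')) => n form0.
rewrite /almost_aut ext_mulE; congr (epair _ _); last first.
  by rewrite wr_mulE /= shear_mul shear_act.
congr (_ + _)%R; rewrite /wr_cocycle /=.
rewrite (@mod2_form_eqr (shear n f) _ (wr_act b f')).
  by rewrite mod2_form_mull form0 addr0.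
by move=> x; rewrite !wr_actE shearE.
Qed.

Lemma shear_a n :
  shear n base_a = wr_base_mul base_a (wr_act (Posz n : Z) base_b).
Proof.
congr wr_base_mul; congr wr_act; apply/fsfunP => x.
rewrite fst_to_sndE !wr_deltaE.
by case: ifP.
Qed.

Lemma shear_b n : shear n base_b = base_b.
Proof.
apply/fsfunP => x; rewrite shearE !wr_deltaE.
by do 2!case: ifP => _; rewrite ?mulg1.
Qed.

Lemma almost_aut_closed_full n (H : {pred TW}) : group_closed H ->
  almost_aut n (ext_bot base_a) \in H -> ext_bot base_b \in H ->
  ext_top (1%R : Z) \in H ->
  forall g, g \in H.
Proof.
move=> HG Ha Hb Ht; have [H1 HD] := HG.
have HM := group_closedM HG; have HV := group_closedV HG.
apply: twisted_closed_full => //.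
have Htn : ext_top (Posz n) \in H.
  by rewrite ext_topX; elim: n {Ha} => [|n IHn]; rewrite ?expg0// expgS HM.
suff -> : ext_bot base_a = almost_aut n (ext_bot base_a) /
    (ext_top (Posz n) * ext_bot base_b * (ext_top (Posz n))^-1).
  by rewrite HD// HM ?HV// HM.
apply/esym/(canLR (mulgK _)); rewrite ext_botJ almost_aut_bot shear_a ext_botM0 //.
by rewrite mod2_form_delta mul0r.
Qed.

(** An endomorphism with these values would fix t ^ n, hence preserve the
    relation [a_0, a_n] = 1; but a_0 b_n and a_n b_2n do not commute. *)
Lemma almost_aut_not_extendable n (f : {multiplicative TW -> TW}) : (0 < n)%N ->
  f (ext_bot base_a) = almost_aut n (ext_bot base_a) ->
  f (ext_top (1%R : Z)) = ext_top (1%R : Z) -> False.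
Proof.
move=> n0 fa ft; pose a := ext_bot base_a; pose tn := ext_top (Posz n).
have fM := @gmulfM _ _ f.
have ftn : f tn = tn.
  rewrite /tn ext_topX; elim: n {tn fa n0} => [|k IHk]; first exact: morph1.
  by rewrite !expgS fM ft IHk.
have comm : commute a (tn * a * tn^-1).
  rewrite /commute /tn ext_botJ wr_act_delta.
  rewrite !ext_botM0 ?mod2_form_delta ?mul0r//; congr ext_bot.
  by apply/fsfunP => x; rewrite !wrE; congr (_, _); exact: mulZC.
(* The images commute only if the form takes the same value on
   (a_0 b_n, a_n b_2n) and in the reverse order. It is 1 in the given order,
   from b_n and a_n, and 0 in the reverse one since n <> 0. *)
have := congr1 f comm; rewrite !fM morphV fa ftn almost_aut_bot ext_botJ !ext_botM.
move=> [/eqP + _]; rewrite shear_a wr_act_mul !mod2_form_mull !mod2_form_mulr.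
rewrite !wr_act_delta !mod2_form_delta !wr_deltaE.
have n1 : ((Posz n : Z) == 1) = false.
  by rewrite -[_ == _]/(n == 0)%N eqn0Ngt n0.
have nn1 : ((Posz n : Z) * (Posz n : Z) == 1) = false.
  by rewrite -[_ == _]/(n + n == 0)%N addn_eq0 eqn0Ngt n0.
have nnn : ((Posz n : Z) * (Posz n : Z) == Posz n) = false.
  by rewrite -(inj_eq (mulgI (Posz n : Z)^-1)) mulKg mulVg.
rewrite !mulg1 !(eq_sym _ ((Posz n : Z) * _)) (eq_sym 1 (Posz n : Z)).
by rewrite n1 nn1 nnn eqxx.
Qed.

Definition twisted_gen (i : 'I_3) : TW :=
  tnth [tuple ext_bot base_a; ext_bot base_b; ext_top (1%R : Z)] i.

Theorem condensed_twisted_wreath : condensed TW.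
Proof.
have Stn (H : {pred TW}) (f : TW -> TW) :
    (forall i, f (twisted_gen i) \in H) ->
    [/\ f (ext_bot base_a) \in H, f (ext_bot base_b) \in H
      & f (ext_top (1%R : Z)) \in H].
  by move=> SH; split; [exact: SH 0%R|exact: SH 1%R|exact: SH 2%R].
apply: (condensed_almost_automorphisms near_almost_autM almost_aut_inj
  (S := twisted_gen)).
- by move=> H HG /(Stn H id)[Ha Hb Ht]; apply: twisted_closed_full.
- apply: filterE => n H HG /(Stn H (almost_aut n))[Ha].
  by rewrite almost_aut_bot shear_b almost_aut_top; apply: almost_aut_closed_full Ha.
- exists 1%N => // n n0 f fS.
  apply: (almost_aut_not_extendable n0 (fS 0%R)).
  by rewrite (fS 2%R) almost_aut_top.
Qed.

Theorem theorem1p5 :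
  exists G : groupType,
    condensed G /\
    central_extension (Algebra.to_multiplicative 'Z_2) G
      (wreath (Algebra.to_multiplicative int * Algebra.to_multiplicative int)%type
              (Algebra.to_multiplicative int)).
Proof.
exists TW; split; first exact: condensed_twisted_wreath.
exact: cocycle_central_extension.
Qed.
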